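(* Let $R$ be a $*$-ring. Then $R$ is a $*$-Boolean ring if and only if (1) $R$ is commutative; (2) every primary ideal of $R$ is maximal; and (3) $R$ is strongly nil $*$-clean.
   Context: All rings are associative with unity. An involution of a ring $R$ is a map $*:R\to R$ with $(x+y)^*=x^*+y^*$, $(xy)^*=y^*x^*$ and $(x^* )^*=x$ for all $x,y\in R$; a ring with an involution is called a $*$-ring. A projection in a $*$-ring is an element $p$ with $p^2=p=p^*$. A $*$-ring is a $*$-Boolean ring if every element of it is a projection. A $*$-ring is strongly nil $*$-clean if every element is the sum of a projection and a nilpotent element that commute with each other. A proper ideal $I$ of a commutative ring $R$ is primary if for all $x,y\in R$, $xy\in I$ implies $x\in I$ or $y^n\in I$ for some $n\in\mathbb{N}$ (positive integers). *)

(* Defs.v *)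
From mathcomp Require Import all_boot all_algebra.
From mathcomp Require Import boolp classical_sets.

Set Implicit Arguments.
Unset Strict Implicit.
Unset Printing Implicit Defensive.

Import GRing.Theory.
Local Open Scope classical_set_scope.
Local Open Scope ring_scope.

(* Rings are [pzRingType]s, so the zero ring is allowed. *)

Definition ring_involution (R : pzRingType) (star : R -> R) : Prop :=
  [/\ {morph star : x y / x + y},
      {morph star : x y / x * y >-> y * x}
    & involutive star].

Definition projection (R : pzRingType) (star : R -> R) (p : R) : Prop :=
  p ^+ 2 = p /\ star p = p.

Definition star_boolean (R : pzRingType) (star : R -> R) : Prop :=
  forall x : R, projection star x.

Definition nilpotent_elt (R : pzRingType) (x : R) : Prop :=
  exists2 n : nat, (0 < n)%N & x ^+ n = 0.

Definition strongly_nil_star_clean (R : pzRingType) (star : R -> R) : Prop :=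
  forall x : R, exists p u : R,
    [/\ projection star p, nilpotent_elt u, GRing.comm p u & x = p + u].

(* The library's [idealr_closed] covers only boolean predicates on nonzero
   rings and builds properness in; here ideals are arbitrary subsets, possibly
   the whole ring. *)
Definition ideal (R : pzRingType) (I : set R) : Prop :=
  [/\ I 0,
      forall x y : R, I x -> I y -> I (x + y)
    & forall a x : R, I x -> I (a * x) /\ I (x * a)].

Definition proper_ideal_set (R : pzRingType) (I : set R) : Prop :=
  ideal I /\ I <> setT.

(* Only meaningful when [R] is commutative. *)
Definition primary_ideal (R : pzRingType) (I : set R) : Prop :=
  proper_ideal_set I /\
  forall x y : R, I (x * y) -> I x \/ exists2 n : nat, (0 < n)%N & I (y ^+ n).

Definition maximal_ideal (R : pzRingType) (I : set R) : Prop :=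
  proper_ideal_set I /\
  forall J : set R, ideal J -> I `<=` J -> J = I \/ J = setT.

(* Main.v *)
Require Import Defs.
From mathcomp Require Import all_boot all_algebra.
From mathcomp Require Import boolp classical_sets.

(** In a Boolean ring x(1 - x) = 0, so a primary ideal contains x or 1 - x for
    every x, and is therefore maximal.  Conversely, suppose that u <> 0 is
    nilpotent and let I be an ideal maximal among those that avoid u.  Such an I
    contains p or 1 - p for every idempotent p.  Write y = p + m with p
    idempotent and m nilpotent: if p is in I then y is nilpotent modulo I, and
    if 1 - p is in I then y is a unit modulo I.  Hence I is primary, so maximal
    by hypothesis, and a maximal ideal contains every nilpotent: a
    contradiction. *)

Set Implicit Arguments.
Unset Strict Implicit.
Unset Printing Implicit Defensive.

Import GRing.Theory.
Local Open Scope classical_set_scope.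
Local Open Scope ring_scope.

Section Ideals.
Variable R : pzRingType.
Implicit Types (I J : set R) (a m p u x y z : R).

Lemma ideal1 I : ideal I -> I 1 -> I = setT.
Proof.
case=> _ _ IM I1; apply/seteqP; split=> // x _.
by rewrite -[x]mulr1; case: (IM x 1 I1).
Qed.

(** The element [1 - m] is a unit: its inverse is the finite geometric sum of the powers of [m]. *)
Lemma ideal_mulr_subr_nilpotent I x m :
  ideal I -> nilpotent_elt m -> I (x * (1 - m)) -> I x.
Proof.
move=> idI [n n_gt0 mn0] Ixm; have [_ _ IM] := idI.
have := subrX1 m n; rewrite mn0 sub0r => e.
have -> : x = x * (1 - m) * (\sum_(i < n) m ^+ i).
  by rewrite -mulrA -opprB mulNr -e opprK mulr1.
by case: (IM (\sum_(i < n) m ^+ i) _ Ixm).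
Qed.

(** If [m ^+ n = 0], then [(p + m) ^+ n] equals [(p + m) ^+ n - m ^+ n], which has the factor
    [(p + m) - m = p]. *)
Lemma ideal_exprD_nilpotent I p m :
  ideal I -> nilpotent_elt m -> GRing.comm p m -> I p ->
  exists2 n : nat, (0 < n)%N & I ((p + m) ^+ n).
Proof.
move=> [_ _ IM] [n n_gt0 mn0] cpm Ip; exists n => //.
have cm : GRing.comm (p + m) m by rewrite /GRing.comm mulrDl mulrDr cpm.
rewrite -[_ ^+ n]subr0 -mn0 subrXX_comm // addrK.
by apply: (IM _ _ Ip).2.
Qed.

Definition ideal_adjoin I a : set R := [set z | exists r, I (z - r * a)].

Lemma sub_ideal_adjoin I a : I `<=` ideal_adjoin I a.
Proof. by move=> x Ix; exists 0; rewrite mul0r subr0. Qed.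

Lemma mem_ideal_adjoin I a : ideal I -> ideal_adjoin I a a.
Proof. by case=> I0 _ _; exists 1; rewrite mul1r subrr. Qed.

Lemma ideal_adjoinP I a :
  commutative (@GRing.mul R) -> ideal I -> ideal (ideal_adjoin I a).
Proof.
move=> mulC idI; have [I0 ID IM] := idI.
have Ml b x : ideal_adjoin I a x -> ideal_adjoin I a (b * x).
  case=> r Ixr; exists (b * r).
  by rewrite -mulrA -mulrBr; case: (IM b _ Ixr).
split; first exact: sub_ideal_adjoin.
  move=> x y [r Ixr] [s Iys]; exists (r + s).
  by rewrite mulrDl opprD addrACA; apply: ID.
by move=> b x Jx; rewrite [x * b]mulC; split; apply: Ml.
Qed.

(** Otherwise [I + R u] is the whole ring, so [I] contains some [1 - r * u], a unit because [r * u]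
    is nilpotent. *)
Lemma maximal_ideal_nilpotent I u :
  commutative (@GRing.mul R) -> maximal_ideal I -> nilpotent_elt u -> I u.
Proof.
move=> mulC [[idI properI] maxI] [n n_gt0 un0].
have [||eqJ|eqJ] := maxI (ideal_adjoin I u).
- exact: ideal_adjoinP.
- exact: sub_ideal_adjoin.
- by rewrite -eqJ; apply: mem_ideal_adjoin.
have [r Ir] : ideal_adjoin I u 1 by rewrite eqJ.
case: properI; apply: ideal1 => //.
apply: (@ideal_mulr_subr_nilpotent I 1 (r * u)) => //; last by rewrite mul1r.
by exists n => //; rewrite exprMn_comm ?un0 ?mulr0 //; apply: mulC.
Qed.

Lemma exists_ideal_maximal_avoiding u : u <> 0 ->
  exists I, [/\ ideal I, ~ I u &
    forall J, ideal J -> I `<=` J -> ~ J u -> J `<=` I].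
Proof.
move=> u_neq0.
(* [0] is not required to lie in [A], so that the empty chain has a bound. *)
pose P : set (set R) := [set A | [/\ forall x y, A x -> A y -> A (x + y),
  forall a x, A x -> A (a * x) /\ A (x * a) & ~ A u]].
have [|A [[AD AM Au] maxA]] := @Zorn_bigcup R P.
  move=> F FP totF; split=> [x y [X FX Xx] [Y FY Yy]|a x [X FX Xx]|[X FX Xu]].
  - have [XY|YX] := totF _ _ FX FY.
      by exists Y => //; have [YD _ _] := FP _ FY; apply: YD => //; apply: XY.
    by exists X => //; have [XD _ _] := FP _ FX; apply: XD => //; apply: YX.
  - have [_ XM _] := FP _ FX; have [Xl Xr] := XM a x Xx.
    by split; exists X.
  - by have [_ _ /(_ Xu)] := FP _ FX.
have A0 : A 0.
  (* Without [0] the set [A] would be empty, since it absorbs products with [0]; then [[set 0]]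
     would be a strictly larger member of [P]. *)
  apply: contrapT => nA0; apply: (maxA [set 0]).
    split=> [x Ax|/(_ 0 erefl)//].
    by case: nA0; rewrite -(mul0r x); case: (AM 0 x Ax).
  split=> [x y -> ->|a x ->|//]; first by rewrite /= addr0.
  by rewrite /= mulr0 mul0r.
exists A; split=> // J [_ JD JM] AJ nJu.
by apply: contrapT => nJA; apply: (maxA J).
Qed.

(** If both fail, maximality puts [u] in [I + R p] and in [I + R (1 - p)]. Multiplying by the
    complementary idempotent gives [u * (1 - p)] and [u * p] in [I], and their sum is [u]. *)
Lemma maximal_avoiding_idempotent I u p :
  commutative (@GRing.mul R) -> ideal I -> ~ I u ->
  (forall J, ideal J -> I `<=` J -> ~ J u -> J `<=` I) ->
  p * p = p -> I p \/ I (1 - p).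
Proof.
move=> mulC idI nIu maxI pp; have [_ ID IM] := idI.
have adjI a : I a \/ ideal_adjoin I a u.
  have [Ju|nJu] := pselect (ideal_adjoin I a u); first by right.
  left; apply: (maxI (ideal_adjoin I a)) => //.
  - exact: ideal_adjoinP.
  - exact: sub_ideal_adjoin.
  - exact: mem_ideal_adjoin.
have [|[r Ir]] := adjI p; first by left.
have [|[s Is]] := adjI (1 - p); first by right.
case: nIu; rewrite -[u]mulr1 -(subrK p 1) mulrDr; apply: ID.
  have := (IM (1 - p) _ Ir).2.
  by rewrite mulrBl -(mulrA r) (mulrBr p) mulr1 pp subrr mulr0 subr0.
have := (IM p _ Is).2.
by rewrite mulrBl -(mulrA s) (mulrBl p) mul1r pp subrr mulr0 subr0.
Qed.

Lemma maximal_avoiding_primary (star : R -> R) I u :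
  commutative (@GRing.mul R) -> strongly_nil_star_clean star ->
  ideal I -> ~ I u ->
  (forall J, ideal J -> I `<=` J -> ~ J u -> J `<=` I) ->
  primary_ideal I.
Proof.
move=> mulC clean idI nIu maxI; split.
  by split=> // IT; apply: nIu; rewrite IT.
move=> x y Ixy; have [p [m [[pp _] nilm cpm y_eq]]] := clean y.
have [_ ID IM] := idI.
have [Ip|Ip] := maximal_avoiding_idempotent mulC idI nIu maxI pp.
  by right; rewrite y_eq; apply: ideal_exprD_nilpotent.
(* Modulo [I], [y] is [1 + m], a unit, so [x] can be recovered from [x * y]. *)
left; apply: (@ideal_mulr_subr_nilpotent I x (- m)) => //.
  by case: nilm => n n_gt0 mn0; exists n; rewrite // exprNn mn0 mulr0.
have -> : x * (1 - - m) = x * y + x * (1 - p).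
  by rewrite y_eq -mulrDr opprK [1 + m]addrC [p + m]addrC -addrA (addrCA p)
     subrr addr0.
by apply: ID => //; case: (IM x _ Ip).
Qed.

Lemma nilpotent_eq0 (star : R -> R) u :
  commutative (@GRing.mul R) ->
  (forall I, primary_ideal I -> maximal_ideal I) ->
  strongly_nil_star_clean star -> nilpotent_elt u -> u = 0.
Proof.
move=> mulC prim_max clean nilu; apply: contrapT => u_neq0.
have [I [idI nIu maxI]] := exists_ideal_maximal_avoiding u_neq0.
have primI := maximal_avoiding_primary mulC clean idI nIu maxI.
exact: nIu (maximal_ideal_nilpotent mulC (prim_max I primI) nilu).
Qed.

(** Squaring [- z] shows [- z = z], and expanding the square of [x + y] leaves
    [x * y + y * x = 0]. *)
Lemma idempotent_ring_mulC :
  (forall x, x * x = x) -> commutative (@GRing.mul R).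
Proof.
move=> idem x y.
have oppE z : - z = z by rewrite -[LHS]idem mulrNN idem.
have := idem (x + y); rewrite mulrDl !mulrDr !idem addrA => /addIr.
rewrite -addrA -[RHS]addr0 => /addrI /eqP.
by rewrite addr_eq0 oppE => /eqP.
Qed.

(** For [x] in [J] outside [I], primariness applied to [x * (1 - x) = 0] puts a power of [1 - x],
    hence [1 - x] itself, in [I]; so [J] contains [1]. *)
Lemma idempotent_ring_primary_maximal I :
  (forall x, x * x = x) -> primary_ideal I -> maximal_ideal I.
Proof.
move=> idem [[idI properI] primI]; have [I0 _ _] := idI; split=> // J idJ IJ.
have [_ JD _] := idJ.
have [JI|/existsNP[x /not_implyP[Jx nIx]]] := pselect (J `<=` I).
  by left; apply/seteqP.
right; apply: ideal1 => //; rewrite -(subrK x 1); apply: JD => //; apply: IJ.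
have idemX y n : (0 < n)%N -> y ^+ n = y.
  by case: n => // n _; elim: n => // n IHn; rewrite exprS IHn idem.
have [|//|[n n_gt0]] := primI x (1 - x).
  by rewrite mulrBr mulr1 idem subrr.
by rewrite idemX.
Qed.

End Ideals.

Theorem theorem4p7 (R : pzRingType) (star : R -> R)
    (hstar : ring_involution star) :
  star_boolean star <->
  [/\ commutative (@GRing.mul R),
      forall I : set R, primary_ideal I -> maximal_ideal I
    & strongly_nil_star_clean star].
Proof.
split=> [bool_star|[mulC prim_max clean] x].
  have idem (x : R) : x * x = x by case: (bool_star x).
  split=> [|I|x]; first exact: idempotent_ring_mulC.
    exact: idempotent_ring_primary_maximal.
  exists x, 0; split; [exact: bool_star | by exists 1%N | | by rewrite addr0].
  by rewrite /GRing.comm mulr0 mul0r.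
have [p [u [proj_p nilu _ ->]]] := clean x.
by rewrite (nilpotent_eq0 mulC prim_max clean nilu) addr0.
Qed.
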